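(* Given a graph $G=(V,E)$ with $n$ vertices and $m$ edges, either an independent set of size $\lceil 2m/n\rceil$ or a triangle in $G$ can be found in $O(m+n)$ time.
   Context: Graphs are finite, simple and undirected. An independent set is a set of pairwise non-adjacent vertices; a triangle is a set of three pairwise adjacent vertices. The graph is assumed available via its adjacency lists and adjacency matrix (adjacency tests in constant time). *)

(* Defs.v *)
From HB Require Import structures.
From mathcomp Require Import all_boot all_order all_algebra.

Set Implicit Arguments.
Unset Strict Implicit.
Unset Printing Implicit Defensive.

Section Graph.
Variables (n : nat) (e : rel 'I_n).

Definition simple_graph : Prop := symmetric e /\ irreflexive e.

Definition edges : {set {set 'I_n}} :=
  [set [set p.1; p.2] | p in [set p : 'I_n * 'I_n | e p.1 p.2]].

Definition independent (S : {set 'I_n}) : Prop :=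
  forall x y, x \in S -> y \in S -> ~~ e x y.

Definition triangle (S : {set 'I_n}) : Prop :=
  #|S| = 3 /\ forall x y, x \in S -> y \in S -> x != y -> e x y.

(* The order in which a list enumerates the neighbours is arbitrary. *)
Definition adjacency_lists (L : 'I_n -> seq 'I_n) : Prop :=
  forall x, uniq (L x) /\ forall y, (y \in L x) = e x y.

End Graph.

(* The machine is the unit-cost random access machine of Cook and Reckhow:
   memory cells X_0, X_1, ... holding natural numbers, addition and (truncated)
   subtraction as the only arithmetic, indirect addressing, conditional jumps
   and a write-only output tape.  The input is read-only and is consulted only
   through [IOrder], [INeighbour] and [IAdjacent]. *)
Inductive instr : Type :=
| IConst of nat & nat             (* X_i := c *)
| IAdd of nat & nat & nat         (* X_i := X_j + X_k *)
| ISub of nat & nat & nat         (* X_i := X_j - X_k *)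
| ILoad of nat & nat              (* X_i := X_(X_j) *)
| IStore of nat & nat             (* X_(X_i) := X_j *)
| IJumpPos of nat & nat           (* if X_j > 0 then go to instruction l *)
| IOrder of nat                   (* X_i := n *)
| INeighbour of nat & nat & nat   (* X_i := entry X_k of the list of X_j *)
| IAdjacent of nat & nat & nat    (* X_i := matrix entry (X_j, X_k) *)
| IPrint of nat.                  (* append X_j to the output *)

Definition program := seq instr.

Record config := Config { cfg_pc : nat; cfg_mem : nat -> nat; cfg_out : seq nat }.

Definition init : config := Config 0 (fun _ => 0) [::].

Definition upd (M : nat -> nat) (i v : nat) : nat -> nat :=
  fun j => if j == i then v else M j.

Section Semantics.
Variables (n : nat) (e : rel 'I_n) (L : 'I_n -> seq 'I_n) (P : program).

(* Lists are accessible as arrays (linked lists can be copied into arrays in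
   O(m + n) time); the value n, not a vertex, signals the end of a list. *)
Definition list_entry (v k : nat) : nat :=
  if insub v is Some x then nth n [seq val y | y <- L x] k else n.

Definition matrix_entry (u v : nat) : nat :=
  if (insub u, insub v) is (Some x, Some y) then nat_of_bool (e x y) else 0.

Definition exec (a : instr) (c : config) : config :=
  let: Config p M o := c in
  match a with
  | IConst i v => Config p.+1 (upd M i v) o
  | IAdd i j k => Config p.+1 (upd M i (M j + M k)) o
  | ISub i j k => Config p.+1 (upd M i (M j - M k)) o
  | ILoad i j => Config p.+1 (upd M i (M (M j))) o
  | IStore i j => Config p.+1 (upd M (M i) (M j)) o
  | IJumpPos j l => Config (if 0 < M j then l else p.+1) M o
  | IOrder i => Config p.+1 (upd M i n) o
  | INeighbour i j k => Config p.+1 (upd M i (list_entry (M j) (M k))) o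
  | IAdjacent i j k => Config p.+1 (upd M i (matrix_entry (M j) (M k))) o
  | IPrint j => Config p.+1 M (rcons o (M j))
  end.

Definition step (c : config) : config :=
  if onth P (cfg_pc c) is Some a then exec a c else c.

Definition halted (c : config) : Prop := size P <= cfg_pc c.

Definition run (t : nat) : config := iter t step init.

(* Within the first t steps every cell holds a word of w * log2 (n + 1) bits;
   this keeps unit cost from hiding arithmetic on long numbers. *)
Definition word_bounded (w t : nat) : Prop :=
  forall s i, s <= t -> cfg_mem (run s) i < n.+1 ^ w.

End Semantics.

(* The first symbol of the output tells which alternative was found. *)
Definition outputs_independent_set n (e : rel 'I_n) (o : seq nat) (k : int) :=
  exists s : seq 'I_n, [/\ o = 0 :: [seq val x | x <- s], uniq s,
    Posz (size s) = k & independent e [set x in s]].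

Definition outputs_triangle n (e : rel 'I_n) (o : seq nat) :=
  exists s : seq 'I_n, [/\ o = 1 :: [seq val x | x <- s], uniq s &
    triangle e [set x in s]].

(* Main.v *)
(* Let D = 2m be the sum of the degrees and k the ceiling of D / n.  A vertex v
   of maximum degree has at least k neighbours.  Two adjacent vertices among the
   first k of them form a triangle with v; otherwise these k neighbours are
   independent.  Since (k - 1) n < D and k <= n, there are at most D pairs to
   test, so this costs O(m + n); the division by n is done by at most n
   subtractions.

   The machine program is verified backwards, from its last instruction to its
   first: each loop is shown to halt correctly within a time budget, given the
   same for the code that follows it. *)

Require Import Defs.
From HB Require Import structures.
From mathcomp Require Import all_boot all_order all_algebra zify.

Set Implicit Arguments.
Unset Strict Implicit.
Unset Printing Implicit Defensive.

Import GRing.Theory Num.Theory.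

(** * Degree sum and number of edges *)

Section Handshake.

Lemma pair_set_eq (T : finType) (x y z t : T) : x != y ->
  ([set z; t] == [set x; y]) =
  ((z, t) == (x, y)) || ((z, t) == (y, x)).
Proof.
move=> xy; rewrite !xpair_eqE; apply/eqP/orP; last first.
  by case=> /andP[/eqP -> /eqP ->] //; rewrite setUC.
move=> E.
have := set21 z t; rewrite E !inE => /orP[] /eqP zE; subst z; [left|right].
  have := set22 x y; rewrite -E !inE [y == x]eq_sym (negbTE xy) /= eqxx.
  by move=> /eqP ->; rewrite eqxx.
have := set21 x y; rewrite -E !inE (negbTE xy) /= eqxx.
by move=> /eqP ->; rewrite eqxx.
Qed.

Variables (n : nat) (e : rel 'I_n).
Hypothesis simple_e : simple_graph e.

(** Both sides count ordered adjacent pairs: the left by first vertex, the right by underlying edge,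
    each edge having two orderings. *)
Lemma handshake (L : 'I_n -> seq 'I_n) : adjacency_lists e L ->
  \sum_(v < n) size (L v) = 2 * #|edges e|.
Proof.
move=> adjL; case: simple_e => sym irr.
transitivity #|[set p : 'I_n * 'I_n | e p.1 p.2]|.
  rewrite -sum1dep_card -(pair_big_dep predT (fun x y => e x y) (fun _ _ => 1)).
  apply: eq_bigr => x _; rewrite sum1_card.
  have [uL memL] := adjL x; rewrite -(card_uniqP uL).
  by apply: eq_card => y; rewrite memL.
rewrite -sum1_card (partition_big_imset (fun p => [set p.1; p.2])) /=.
rewrite -/(edges e) mulnC -sum_nat_const; apply: eq_bigr => S.
case/imsetP=> -[x y]; rewrite inE /= => exy ->.
have xy : x != y by apply/eqP=> E; rewrite E irr in exy.
rewrite sum1dep_card.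
have <- : #|[set (x, y); (y, x)]| = 2.
  by rewrite cards2 xpair_eqE (negbTE xy).
apply: eq_card => -[z t]; rewrite !inE /= pair_set_eq // andb_idl //.
by case/orP=> /eqP[-> ->]; rewrite // sym.
Qed.

End Handshake.

(** The hypotheses are [k - 1 < a / n <= k] cleared of division and subtraction, the form in which a
    loop of subtractions yields them. *)
Lemma ceil_nat_div (a n k : nat) : 0 < n -> a <= k * n -> k * n < a + n ->
  Num.ceil (a%:R / n%:R : rat)%R = Posz k.
Proof.
move=> n0 ak ka; apply/ceil_def.
have n0' : (0 < n%:R :> rat)%R by rewrite ltr0n.
rewrite ltr_pdivlMr // ler_pdivrMr // rmorphB /= mulrBl mul1r.
rewrite ltrBlDr -!pmulrn -!natrM -natrD ltr_nat ler_nat.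
by rewrite ka.
Qed.

(** * Symbolic execution with time budgets *)

Section SymbolicExecution.

Variables (n : nat) (e : rel 'I_n) (L : 'I_n -> seq 'I_n) (P : program).

(* A memory is represented by the sequence of its first cells, the others being
   0, so that running a concrete program reduces by computation. *)
Definition sexec (a : instr) (c : nat * seq nat * seq nat) :=
  let: (p, s, o) := c in
  match a with
  | IConst i v => (p.+1, set_nth 0 s i v, o)
  | IAdd i j k => (p.+1, set_nth 0 s i (nth 0 s j + nth 0 s k), o)
  | ISub i j k => (p.+1, set_nth 0 s i (nth 0 s j - nth 0 s k), o)
  | ILoad i j => (p.+1, set_nth 0 s i (nth 0 s (nth 0 s j)), o)
  | IStore i j => (p.+1, set_nth 0 s (nth 0 s i) (nth 0 s j), o)
  | IJumpPos j l => (if 0 < nth 0 s j then l else p.+1, s, o)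
  | IOrder i => (p.+1, set_nth 0 s i n, o)
  | INeighbour i j k =>
      (p.+1, set_nth 0 s i (list_entry L (nth 0 s j) (nth 0 s k)), o)
  | IAdjacent i j k =>
      (p.+1, set_nth 0 s i (matrix_entry e (nth 0 s j) (nth 0 s k)), o)
  | IPrint j => (p.+1, s, rcons o (nth 0 s j))
  end.

Definition represents (c : config) (d : nat * seq nat * seq nat) : Prop :=
  [/\ cfg_pc c = d.1.1, cfg_mem c =1 nth 0 d.1.2 & cfg_out c = d.2].

Lemma represents_exec a c d :
  represents c d -> represents (exec e L a c) (sexec a d).
Proof.
case: c d => [p M o] [[q s] r] [/= -> Ms ->].
by case: a => *; split; rewrite /= ?Ms // => i; rewrite nth_set_nth /= /upd !Ms.
Qed.

Variables (B : nat) (Q : seq nat -> Prop).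
Hypothesis B_gt0 : 0 < B.

(* Time b suffices for every configuration represented by d to halt with an
   output in Q, all cells staying below B. *)
Definition wp (b : nat) (d : nat * seq nat * seq nat) : Prop :=
  forall c, represents c d -> exists t,
    [/\ t <= b, halted P (iter t (step e L P) c),
        forall u i, u <= t -> cfg_mem (iter u (step e L P) c) i < B
      & Q (cfg_out (iter t (step e L P) c))].

Lemma wp_le b b' d : wp b' d -> b' <= b -> wp b d.
Proof.
move=> W le c /W[t [tb ? ? ?]]; exists t; split=> //; exact: leq_trans le.
Qed.

Lemma represents_bound c d i : all (fun x => x < B) d.1.2 ->
  represents c d -> cfg_mem c i < B.
Proof.
move=> sB [_ -> _]; have [si|si] := ltnP i (size d.1.2).
  exact: (all_nthP 0 sB).
by rewrite nth_default.
Qed.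

Lemma wp_step b a p s o : onth P p = Some a -> all (fun x => x < B) s ->
  wp b (sexec a (p, s, o)) -> wp b.+1 (p, s, o).
Proof.
move=> Pp sB W c rc.
have stepE : step e L P c = exec e L a c.
  by rewrite /step; case: rc => /= -> _ _; rewrite Pp.
case/(represents_exec a)/W: (rc); rewrite -stepE => t [tb Ht Bt Qt].
exists t.+1; rewrite iterSr; split=> // -[|u] i ut.
  exact: represents_bound rc.
rewrite iterSr; exact: Bt.
Qed.

Lemma wp_halt p s o : size P <= p -> all (fun x => x < B) s -> Q o ->
  wp 0 (p, s, o).
Proof.
move=> Pp sB Qo c rc; exists 0; split=> //=.
- by case: rc; rewrite /halted => /= ->.
- by case=> // i _; apply: represents_bound rc.
- by case: rc => _ _ ->.
Qed.

End SymbolicExecution.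

(** * The program and its registers *)

(* The cells Zero and One keep the values 0 and 1 after instruction 1. *)
Local Notation Zero := 0 (only parsing).
Local Notation One := 1 (only parsing).
Local Notation N := 2 (only parsing).
Local Notation V := 3 (only parsing).
Local Notation J := 4 (only parsing).
Local Notation T := 5 (only parsing).
Local Notation Best := 6 (only parsing).
Local Notation BestV := 7 (only parsing).
Local Notation K := 8 (only parsing).
Local Notation I := 9 (only parsing).
Local Notation X := 10 (only parsing).
Local Notation Y := 11 (only parsing).
Local Notation Tmp := 12 (only parsing).

Definition prog : program :=
  [:: IOrder N;
      IConst One 1;
      (* 2: scan the list of V, adding its length J to T *)
      IConst J 0;
      IJumpPos One 6;
      IAdd J J One;
      IAdd T T One;
      INeighbour Tmp V J;
      ISub Tmp N Tmp;
      IJumpPos Tmp 4;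
      (* 9: keep the vertex of largest degree *)
      IAdd Tmp Best One;
      ISub Tmp Tmp J;
      IJumpPos Tmp 14;
      IAdd Best J Zero;
      IAdd BestV V Zero;
      IAdd V V One;
      ISub Tmp N V;
      IJumpPos Tmp 2;
      (* 17: divide T by N, rounding up *)
      IJumpPos One 20;
      ISub T T N;
      IAdd K K One;
      IJumpPos T 18;
      (* 21: test the pairs J < I < K of neighbours of BestV *)
      IAdd I K Zero;
      IJumpPos One 32;
      ISub I I One;
      INeighbour X BestV I;
      IAdd J I Zero;
      IJumpPos One 31;
      ISub J J One;
      INeighbour Y BestV J;
      IAdjacent Tmp X Y;
      IJumpPos Tmp 40;
      IJumpPos J 27;
      IJumpPos I 23;
      (* 33: print the first K neighbours of BestV *)
      IPrint Zero;
      IJumpPos One 38;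
      ISub K K One;
      INeighbour Y BestV K;
      IPrint Y;
      IJumpPos K 35;
      IJumpPos One 44;
      (* 40: print the triangle *)
      IPrint One;
      IPrint BestV;
      IPrint X;
      IPrint Y].

Definition regs n v j t b bv k i x y tmp :=
  [:: 0; 1; n; v; j; t; b; bv; k; i; x; y; tmp].

(** After [eapply wp_le] the budget is an open variable. Each [wstep] adds one to it by unification,
    and a final [lia] compares the count with the claimed budget. *)
Ltac wstep := apply: wp_step;
  [ lia | reflexivity | rewrite /= ?andbT; lia
  | rewrite /sexec /= ?addn0 ?addn1 ?subn1 /= ].

(** * Correctness and running time of [prog] *)

Section Verification.

Variables (n : nat) (e : rel 'I_n) (L : 'I_n -> seq 'I_n).
Hypotheses (simple_e : simple_graph e) (adjL : adjacency_lists e L).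

Variable B : nat.
(** The extreme cell contents are [Best + 1], at most [n + 1], and the degree sum in [T], at most
    [n * n]. *)
Hypotheses (B_gt : n.+1 < B) (B_gt2 : n * n < B).
Let D := \sum_(v < n) size (L v).
Let Q o := outputs_independent_set e o (Num.ceil (D%:R / n%:R : rat)%R)
           \/ outputs_triangle e o.
Local Notation wpn := (wp e L prog B Q).

Lemma size_adj v : size (L v) <= n.
Proof.
rewrite -[n in _ <= n]card_ord; have [uL _] := adjL v.
by rewrite -(card_uniqP uL) max_card.
Qed.

Lemma list_entry_lt v i : i < size (L v) -> list_entry L v i = nth v (L v) i.
Proof. by move=> iv; rewrite /list_entry valK (nth_map v). Qed.

Lemma list_entry_ge v i : size (L v) <= i -> list_entry L v i = n.
Proof. by move=> iv; rewrite /list_entry valK nth_default ?size_map. Qed.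

Lemma matrix_entryE (x y : 'I_n) : matrix_entry e x y = e x y.
Proof. by rewrite /matrix_entry !valK. Qed.

Lemma nth_adj v i : i < size (L v) -> e v (nth v (L v) i).
Proof. by move=> iv; rewrite -(adjL v).2 mem_nth. Qed.

Lemma sum_degrees_le : D <= n * n.
Proof.
rewrite -[n in n * _]card_ord -sum_nat_const; apply: leq_sum => v _.
exact: size_adj.
Qed.

(** * Testing pairs of neighbours and printing the result *)

Section Neighbourhood.

Variables (bv : 'I_n) (kk : nat).
Hypotheses (kk_le : kk <= size (L bv))
           (kkE : Num.ceil (D%:R / n%:R : rat)%R = Posz kk).

Local Notation nb := (nth bv (L bv)).

(* The pairs already tested when the two nested loops of instructions 23-32,
   which run downwards, have reached (i, j). *)
Definition checked i j := forall a b, a < b < kk ->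
  (i < b) || (b == i) && (j <= a) -> ~~ e (nb b) (nb a).

Lemma take_independent :
  (forall a b, a < b < kk -> ~~ e (nb b) (nb a)) ->
  independent e [set x in take kk (L bv)].
Proof.
case: simple_e => sym irr H.
have ix x : x \in take kk (L bv) -> exists2 a, a < kk & x = nb a.
  move=> xs; exists (index x (take kk (L bv))).
    by move: (xs); rewrite -index_mem size_takel.
  rewrite -(nth_take (n0 := kk)) ?nth_index //.
  by rewrite -[ltnRHS](size_takel kk_le) index_mem.
move=> x y; rewrite !inE => /ix[a ak ->] /ix[b bk ->].
case: (ltngtP a b) => [ab|ab|->]; last by rewrite irr.
  by rewrite sym H // ab.
by rewrite H // ab.
Qed.

Lemma triangle_seq i j : j < i -> i < size (L bv) -> e (nb i) (nb j) ->
  outputs_triangle e [:: 1; val bv; val (nb i); val (nb j)].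
Proof.
case: simple_e => sym irr ji ik eij.
have ei := nth_adj ik; have ej := nth_adj (ltn_trans ji ik).
have ne x y : e x y -> x != y.
  by move=> exy; apply/eqP => E; rewrite E irr in exy.
exists [:: bv; nb i; nb j].
have u : uniq [:: bv; nb i; nb j].
  by rewrite /= !inE negb_or !(ne _ _ ei, ne _ _ ej, ne _ _ eij).
split=> //; split; first by rewrite cardsE (card_uniqP u).
move=> x y; rewrite !inE.
by do 2!case/or3P=> /eqP ->; rewrite ?eqxx // => _; rewrite // sym.
Qed.

(** Printing runs down from index [kk - 1], so the output so far is a reversed suffix. [checked 0 0]
    covers every pair, since [a < b] forces [0 < b]. *)
Lemma wp_print_set v j t b k i x y tmp :
  checked 0 0 -> k <= kk ->
  all (fun x => x < B) (regs n v j t b bv k i x y tmp) ->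
  wpn (4 * k + 2) (38, regs n v j t b bv k i x y tmp,
    0 :: [seq val x | x <- rev (drop k (take kk (L bv)))]).
Proof.
move=> chk; elim: k y => [|k IH] y k_le; rewrite /regs /= => Bs.
  rewrite drop0; eapply wp_le.
    do 2!wstep; apply: wp_halt => //=; first lia.
    left; exists (rev (take kk (L bv))); split=> //.
    - by rewrite rev_uniq take_uniq //; case: (adjL bv).
    - by rewrite size_rev size_takel // kkE.
    - move=> x1 y1; rewrite !inE !mem_rev => x1s y1s.
      apply: take_independent; rewrite ?inE // => a c /andP[ac ck].
      by apply: chk; lia.
  by lia.
have k_lt : k < size (L bv) by lia.
have nbk := ltn_ord (nb k).
eapply wp_le.
  do 3!wstep; rewrite list_entry_lt //; wstep.
  have -> : rcons [seq val x | x <- rev (drop k.+1 (take kk (L bv)))] (nb k)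
     = [seq val x | x <- rev (drop k (take kk (L bv)))].
    rewrite [in RHS](drop_nth bv) ?size_takel //.
    by rewrite rev_cons map_rcons nth_take.
  by apply: IH => /=; lia.
by lia.
Qed.


(** One iteration takes 5 steps and [c] pays for what follows the loop. The additive 5 covers the
    exit to the triangle printer, where [X] and [Y] still hold the adjacent pair. *)
Lemma wp_test_inner v t b i c : i < kk -> v < B -> t < B -> b < B ->
  (forall j y tmp, j < B -> y < B -> tmp < B -> checked i 0 ->
     wpn c (32, regs n v j t b bv kk i (nb i) y tmp, [::])) ->
  forall j y tmp, j <= i -> y < B -> tmp < B -> checked i j ->
  wpn (5 * j + 5 + c) (31, regs n v j t b bv kk i (nb i) y tmp, [::]).
Proof.
move=> ik vB tB bB next; have kn := leq_trans kk_le (size_adj bv).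
have nbi := ltn_ord (nb i); have bvn := ltn_ord bv.
elim=> [|j IH] y tmp ji yB tmpB chk; rewrite /regs.
  by eapply wp_le; [wstep; apply: next => //; lia | lia].
have nbj := ltn_ord (nb j).
case eij: (e (nb i) (nb j)).
  eapply wp_le.
    do 3!wstep; rewrite list_entry_lt; last lia.
    wstep; rewrite matrix_entryE eij.
    do 5!wstep; apply: wp_halt => //=; [lia | lia |].
    by right; apply: triangle_seq => //; lia.
  by lia.
eapply wp_le.
  do 3!wstep; rewrite list_entry_lt; last lia.
  wstep; rewrite matrix_entryE eij; wstep.
  apply: IH => //; try lia.
  move=> a d adk H; have [/andP[/eqP -> /eqP ->]|ne] :=
    boolP ((d == i) && (a == j)); first by rewrite eij.
  by apply: chk; lia.
by lia.
Qed.

Lemma wp_test v t b i j x y tmp : v < B -> t < B -> b < B -> i <= kk ->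
  j < B -> x < B -> y < B -> tmp < B -> checked i 0 ->
  wpn (i * (5 * kk + 11) + (4 * kk + 5))
    (32, regs n v j t b bv kk i x y tmp, [::]).
Proof.
move=> vB tB bB; have kn := leq_trans kk_le (size_adj bv).
have bvn := ltn_ord bv.
elim: i j x y tmp => [|i IH] j x y tmp ik jB xB yB tmpB chk; rewrite /regs.
  eapply wp_le.
    do 3!wstep.
    have := wp_print_set (v := v) (j := j) (t := t) (b := b) (k := kk)
      (i := 0) (x := x) (y := y) (tmp := tmp) chk (leqnn kk).
    by rewrite drop_oversize ?size_takel //; apply; rewrite /=; lia.
  by lia.
have nbi := ltn_ord (nb i).
eapply wp_le.
  do 3!wstep; rewrite list_entry_lt; last lia.
  do 2!wstep; apply: wp_test_inner => //; try lia.
    by move=> j' y' tmp' *; apply: IH => //; lia.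
  (* [checked i i] claims nothing beyond [checked i.+1 0]: a pair with larger index [i] has its
     smaller index below [i]. *)
  by move=> a d adk H; apply: chk; lia.
by lia.
Qed.

End Neighbourhood.

(** The loop stops at the first [k] with [D <= k * n], at the latest at [k = n]. Entering at the
    test lets an edgeless graph leave with [k = 0]. *)
Lemma wp_divide (bv : 'I_n) v j t b k tmp :
  (forall u, size (L u) <= size (L bv)) ->
  v < B -> j < B -> b < B -> tmp < B -> k <= n -> k * n < D + n ->
  t = D - k * n ->
  wpn (3 * (n - k) + (5 * D + 20 * n + 8))
    (20, regs n v j t b bv k 0 0 0 tmp, [::]).
Proof.
move=> maxbv vB jB bB tmpB.
have bvn := ltn_ord bv; have Dn := sum_degrees_le.
have n0 : 0 < n by lia.
have DM : D <= n * size (L bv).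
  by rewrite -[n in n * _]card_ord -sum_nat_const; apply: leq_sum.
(* Here [(k' - 1) * n < D]. With [D <= n * size (L bv)] this provides enough neighbours; with
   [k' <= n] it gives [k' * k' <= D + k'], so the quadratic pair test costs [O(D + n)]. *)
have exit k' : D <= k' * n -> k' * n < D + n ->
    wpn (5 * D + 20 * n + 8) (20, regs n v j 0 b bv k' 0 0 0 tmp, [::]).
  move=> Dk kD; have kb : k' <= size (L bv) by nia.
  have bn := size_adj bv; have kk : k' * k' <= D + k' by nia.
  rewrite /regs; eapply wp_le.
    do 3!wstep; apply: (wp_test kb (ceil_nat_div n0 Dk kD)) => //; try lia.
    by move=> a d; lia.
  by nia.
move Er : (n - k) => r; elim: r k Er t => [|r IH] k Er t kn kD tE.
  have -> : t = 0 by nia.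
  by apply: wp_le (exit k _ kD) _; nia.
have [Dk|Dk] := leqP D (k * n).
  have -> : t = 0 by lia.
  by apply: wp_le (exit k _ kD) _; lia.
have t0 : 0 < t by lia.
have tB : t < B by lia.
rewrite /regs; eapply wp_le.
  wstep; rewrite t0; do 2!wstep; apply: IH; lia.
by lia.
Qed.

(** * Degree sums and the search for a vertex of maximum degree *)

Definition degsum v := \sum_(u < n | u < v) size (L u).

Lemma degsumS (v : 'I_n) : degsum v.+1 = degsum v + size (L v).
Proof.
rewrite /degsum (bigD1 v) //= addnC; congr (_ + _).
by apply: eq_bigl => u; rewrite ltnS -val_eqE /= ltn_neqAle andbC.
Qed.

Lemma degsum_le v : degsum v <= D.
Proof. by rewrite /D (bigID (fun u : 'I_n => u < v)) leq_addr. Qed.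

(** [Tmp] becomes [n] minus the entry: positive for a vertex, 0 for the end marker [n]. *)
Lemma wp_scan_list (v : 'I_n) b (bv : 'I_n) c :
  b <= n ->
  (forall tmp, tmp < B ->
    wpn c (9, regs n v (size (L v)) (degsum v.+1) b bv 0 0 0 0 tmp, [::])) ->
  forall d j tmp, j + d = size (L v) -> tmp < B ->
  wpn (5 * d + 3 + c)
    (6, regs n v j (degsum v + j) b bv 0 0 0 0 tmp, [::]).
Proof.
move=> bn next; have vn := ltn_ord v; have bvn := ltn_ord bv.
have Dn := sum_degrees_le; have := degsum_le v.+1; rewrite degsumS => sD.
have vd := size_adj v.
elim=> [|d IH] j tmp jd tmpB; rewrite /regs.
  rewrite addn0 in jd; rewrite jd -degsumS in sD *.
  eapply wp_le.
    wstep; rewrite list_entry_ge //; do 2!wstep; rewrite subnn.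
    by apply: next; lia.
  by lia.
have jv : j < size (L v) by lia.
have nbj := ltn_ord (nth v (L v) j).
have nj : 0 < n - nth v (L v) j by lia.
eapply wp_le.
  wstep; rewrite list_entry_lt //; do 2!wstep; rewrite nj; do 2!wstep.
  by rewrite -addnS; apply: IH; lia.
by lia.
Qed.

(** [rest] is the degree sum of the [r] vertices still to scan. Only [b <= size (L bv)] is kept, not
    equality, because the scan starts with [Best] and [BestV] both 0. *)
Lemma wp_scan r rest v j b (bv : 'I_n) tmp :
  v + r = n -> 0 < r -> degsum v + rest = D -> j < B -> tmp < B ->
  b <= size (L bv) -> (forall u : 'I_n, u < v -> size (L u) <= b) ->
  wpn (5 * rest + 13 * r + (3 * n + (5 * D + 20 * n + 9)))
    (2, regs n v j (degsum v) b bv 0 0 0 0 tmp, [::]).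
Proof.
have Dn := sum_degrees_le.
elim: r rest v j b bv tmp => // r IH rest v j b bv tmp vr _ sv jB tmpB bbv binv.
have vn : v < n by lia.
pose v' := Ordinal vn; have := degsum_le v.+1; have := degsum_le v.
rewrite (degsumS v') /= => sD sD'.
have bvn := ltn_ord bv; have bvd := size_adj bv; have vd := size_adj v'.
(* The branches that keep and that replace the best vertex meet at instruction 14. *)
have next b' (bv' : 'I_n) tmp' : tmp' < B -> b' <= size (L bv') ->
    b <= b' -> size (L v') <= b' ->
    wpn (5 * (rest - size (L v')) + 13 * r + (3 * n + (5 * D + 20 * n + 12)))
     (14, regs n v (size (L v')) (degsum v.+1) b' bv' 0 0 0 0 tmp', [::]).
  move=> tB' bbv' bb' vb'; have bvn' := ltn_ord bv'; have bvd' := size_adj bv'.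
  have binv' (u : 'I_n) : u < v.+1 -> size (L u) <= b'.
    rewrite ltnS leq_eqVlt => /orP[/eqP uv|/binv]; last lia.
    by have -> : u = v' by apply: val_inj.
  have sv' := degsumS v'; rewrite /= in sv'; rewrite /regs.
  case: r IH vr => [|r] IH vr.
    have vE : v.+1 = n by lia.
    have nv : n - v.+1 = 0 by lia.
    have sDE : degsum v.+1 = D.
      by rewrite vE; apply: eq_bigl => u; rewrite ltn_ord.
    eapply wp_le.
      do 3!wstep; rewrite nv; wstep.
      apply: (wp_divide (bv := bv')) => //; try lia.
      by move=> u; apply: leq_trans bbv'; apply: binv'; rewrite vE.
    by lia.
  have vn' : 0 < n - v.+1 by lia.
  eapply wp_le.
    by do 3!wstep; rewrite vn'; apply: (IH (rest - size (L v'))) => //; lia.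
  by lia.
pose c := 5 * (rest - size (L v')) + 13 * r + (3 * n + (5 * D + 20 * n + 12)).
rewrite /regs; eapply wp_le.
  do 2!wstep; rewrite -[degsum v]addn0.
  (* The extra 5 pays for instructions 9 to 13. *)
  apply: (wp_scan_list (v := v') (c := c + 5)) => //; first lia.
  move=> tmp' tB'; have := degsum_le v.+1; rewrite /regs /= => sD2.
  have [bv_ge|bv_lt] := leqP (size (L v')) b.
    have pos : 0 < b.+1 - size (L v') by lia.
    eapply wp_le; first by do 3!wstep; rewrite pos; apply: next; lia.
    by lia.
  have neg : b.+1 - size (L v') = 0 by lia.
  eapply wp_le.
    do 3!wstep; rewrite neg; do 2!wstep.
    by apply: (next _ v'); lia.
  by lia.
by lia.
Qed.

Lemma wp_prog : 0 < n -> wpn (10 * D + 36 * n + 11) (0, nseq 13 0, [::]).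
Proof.
move=> n0; eapply wp_le.
  do 2!wstep; have d0 : degsum 0 = 0 by apply: big_pred0.
  have := @wp_scan n D 0 0 0 (Ordinal n0) 0; rewrite d0; apply=> //; lia.
by lia.
Qed.

End Verification.

Theorem theorem8 :
  exists (P : program) (C w : nat),
  forall (n : nat) (e : rel 'I_n) (L : 'I_n -> seq 'I_n),
    0 < n -> simple_graph e -> adjacency_lists e L ->
    let m := #|edges e| in
    exists t : nat,
      [/\ t <= C * (m + n),
          halted P (run e L P t),
          word_bounded e L P w t
        & outputs_independent_set e (cfg_out (run e L P t))
            (Num.ceil ((2 * m)%:R / n%:R : rat)%R)
          \/ outputs_triangle e (cfg_out (run e L P t))].
Proof.
(* With [D = 2 * m] the budget is [20 * m + 36 * n + 11], and [11 <= 11 * n]. *)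
exists prog, 47, 2 => n e L n0 simple_e adjL m.
have B1 : n.+1 < n.+1 ^ 2 by nia.
have B2 : n * n < n.+1 ^ 2 by nia.
have rep0 : represents init (0, nseq 13 0, [::]).
  by split=> // i; rewrite /= -[RHS]/(nth 0 (nseq 13 0) i) nth_nseq if_same.
have [t []] := wp_prog simple_e adjL B1 B2 n0 rep0.
rewrite (handshake simple_e adjL) => tb ht Bt Qt.
exists t; split=> //; first by apply: leq_trans tb _; lia.
Qed.
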